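(* Let $\ell:[a,b]\to\Lambda(n)$ be a $C^k$ path of Lagrangian planes, $\ell_*\in\Lambda(n)$ a reference plane, $j\le k$, and let $t_0\in(a,b)$ be an isolated crossing ($\ell(t_0)\cap\ell_*\ne\{0\}$ and $\ell(t)\cap\ell_*=\{0\}$ for $t\neq t_0$ near $t_0$). Suppose the crossing forms satisfy $Q^{(i)}(v)=0$ for all $v\in\ell(t_0)\cap\ell_*$ and $i=1,\dots,j-1$, and $Q^{(j)}$ restricted to $\ell(t_0)\cap\ell_*$ is nondegenerate. Then there exists $\delta>0$ such that: (i) if $j$ is even, $\mathrm{Mas}(\ell,\ell_*;|t-t_0|<\delta)=0$; (ii) if $j$ is odd, $\mathrm{Mas}(\ell,\ell_*;|t-t_0|<\delta)=\mathrm{sign}\,Q^{(j)}|_{\ell(t_0)\cap\ell_*}$.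
   Context: $\mathbb R^{2n}$ has symplectic form $\omega(u,v)=\langle u,Jv\rangle$, $J=\begin{pmatrix}0&I_n\\-I_n&0\end{pmatrix}$; $\Lambda(n)$ is the set of Lagrangian planes. Let $\mathcal W\in\Lambda(n)$ with $\mathcal W\cap\ell(t_0)=\{0\}$ and for $t$ near $t_0$ let $A(t):\ell(t_0)\to\mathcal W$ be the graph map, i.e. the unique linear map with $\ell(t)=\{v+A(t)v:v\in\ell(t_0)\}$. The $j$-th order crossing form is $Q^{(j)}(v)=\frac{d^j}{dt^j}\omega(v,A(t)v)|_{t=t_0}$ for $v\in\ell(t_0)\cap\ell_*$ (independent of $\mathcal W$). Let $\Pi$ be the orthogonal projection of $\mathbb R^{2n}$ onto $\ell(t_0)\cap\ell_*$; then $\Pi JA(t)\Pi$ is a symmetric matrix. For an isolated crossing $t_0$ and small $\delta>0$, the Maslov index is given by the spectral flow formula $\mathrm{Mas}(\ell,\ell_*;|t-t_0|\le\delta)=\tfrac12\mathrm{sign}\big(\Pi JA(t_0+\delta)\Pi\big)-\tfrac12\mathrm{sign}\big(\Pi JA(t_0-\delta)\Pi\big)$, where sign is number of positive minus number of negative eigenvalues. *)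

(* Defs.v *)
From HB Require Import structures.
From mathcomp Require Import all_boot all_order all_algebra.
From mathcomp Require Import classical_sets boolp reals topology normedtype derive.
Set Implicit Arguments. Unset Strict Implicit. Unset Printing Implicit Defensive.
Import Order.TTheory GRing.Theory Num.Theory numFieldNormedType.Exports.
Local Open Scope ring_scope.

Section Maslov.
Variables (R : realType) (n : nat).

(* vectors of R^{2n} are column vectors 'cV_(n+n); subspaces are row spaces
   (mxalgebra) of matrices whose rows (transposed) span them *)
Definition Jmx : 'M[R]_(n + n) := block_mx 0 1%:M (- 1%:M) 0.

Definition omega (u v : 'cV[R]_(n + n)) : R := (u^T *m Jmx *m v) 0 0.

Definition inS m (v : 'cV[R]_(n + n)) (S : 'M[R]_(m, n + n)) : Prop :=
  (v^T <= S)%MS.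

Definition lagrangian m (S : 'M[R]_(m, n + n)) : Prop :=
  \rank S = n /\ forall u v, inS u S -> inS v S -> omega u v = 0.

(* graph map A : ell(t0) -> W with ell(t) = {v + A v : v in ell(t0)}
   (as a matrix acting on column vectors; its values off ell(t0) are
   irrelevant for everything below) *)
Definition graph_map m (W L0 Lt : 'M[R]_(m, n + n)) : 'M[R]_(n + n) :=
  xget 0 [set A : 'M[R]_(n + n) | forall v, inS v L0 ->
            inS (A *m v) W /\ inS (v + A *m v) Lt].

Definition orth_proj m (S : 'M[R]_(m, n + n)) : 'M[R]_(n + n) :=
  let B := row_base S in B^T *m invmx (B *m B^T) *m B.

Definition eigvals p (M : 'M[R]_p) : seq R :=
  xget [::] [set s : seq R | char_poly M = \prod_(x <- s) ('X - x%:P)].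

Definition msign p (M : 'M[R]_p) : int :=
  (count (fun x => 0 < x) (eigvals M))%:Z - (count (fun x => x < 0) (eigvals M))%:Z.

Definition gram m (q : 'cV[R]_(n + n) -> R) (S : 'M[R]_(m, n + n)) :=
  let B := row_base S in
  \matrix_(i, k) ((q ((row i B)^T + (row k B)^T) - q (row i B)^T - q (row k B)^T) / 2).

Definition nondeg_on m (q : 'cV[R]_(n + n) -> R) (S : 'M[R]_(m, n + n)) : Prop :=
  gram q S \in unitmx.
Definition qsign_on m (q : 'cV[R]_(n + n) -> R) (S : 'M[R]_(m, n + n)) : int :=
  msign (gram q S).

Definition crossQ (F : R -> 'M[R]_(n, n + n)) (W : 'M[R]_(n, n + n)) (t0 : R)
  (j : nat) (v : 'cV[R]_(n + n)) : R :=
  derive1n j (fun t => omega v (graph_map W (F t0) (F t) *m v)) t0.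

(* local Maslov index over |t - t0| <= d via the spectral flow formula *)
Definition Mas_loc (F : R -> 'M[R]_(n, n + n)) (Ls W : 'M[R]_(n, n + n))
  (t0 d : R) : R :=
  let P := orth_proj (F t0 :&: Ls)%MS in
  let M t := P *m Jmx *m graph_map W (F t0) (F t) *m P in
  ((msign (M (t0 + d)))%:~R - (msign (M (t0 - d)))%:~R) / 2.

Definition Ck_on (k : nat) (f : R -> R) (A : set R) : Prop :=
  (forall m, (m < k)%N -> forall x, A x -> derivable (derive1n m f) x 1) /\
  (forall x, A x -> {for x, continuous (derive1n k f)}).

Definition Ck_path (k : nat) (F : R -> 'M[R]_(n, n + n)) (a b : R) : Prop :=
  forall i j, Ck_on k (fun t => F t i j) (fun t => a < t < b).

End Maslov.

(* Main.v *)
Require Import Defs.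
From HB Require Import structures.
From mathcomp Require Import all_boot all_order all_algebra.
From mathcomp Require Import classical_sets boolp functions reals topology normedtype derive complex zify ring lra.
Set Implicit Arguments. Unset Strict Implicit. Unset Printing Implicit Defensive.
Import Order.TTheory GRing.Theory Num.Theory numFieldNormedType.Exports.
Local Open Scope ring_scope.

(** Near [t0] the matrix of [v |-> omega v (A(t) v)] in a basis of [ell(t0)] is a rational
function of the entries of [F t], so it inherits the regularity of the path. On
[K = ell(t0) /\ ell_*] its derivatives of order below [j] vanish, and Taylor's formula gives
[H(t) = (t - t0)^j / j! G + o(|t - t0|^j)] with [G] the Gram matrix of [Q^(j)]. The matrix
[P J A(t) P] is congruent to [H(t)] on [K] and has rank at most [dim K]; since [G] is
nondegenerate, a min-max argument forces its inertia to be that of [(t - t0)^j G]. *)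

(** * Inertia of real symmetric matrices and its stability under perturbation *)

Section Inertia.
Context {R : realType}.
Local Notation C := R[i].
Local Open Scope sesquilinear_scope.

Local Notation cmx := (map_mx (real_complex R)).

(** The positive index of inertia. The negative index is written [npos (- S)], so that a lower bound
    is proved once and applied to both [S] and [- S]. *)
Definition npos {p} (S : 'M[R]_p) : nat := count (fun x => 0 < x) (eigvals S).

(** The diagonalizing matrix is complex because the spectral theorem is used over [R[i]]; the
    eigenvalues stay in [R] to be compared with [eigvals]. *)
Definition spectral_pair {p} (S : 'M[R]_p) (U : 'M[C]_p) (d : 'rV[R]_p) : Prop :=
  U \is unitarymx /\ cmx S = U ^t* *m diag_mx (cmx d) *m U.

Lemma spectral_pair_ex {p} (S : 'M[R]_p) :
  S^T = S -> exists U d, spectral_pair S U d.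
Proof.
move=> symS.
have Sreal : cmx S \is a mxOver Num.real.
  by apply/mxOverP => i j; rewrite mxE; apply/complex_realP; eexists.
have Sherm : cmx S \is hermsymmx.
  apply: realsym_hermsym => //; apply/is_hermitianmxP.
  by rewrite expr0 scale1r map_mx_id // map_trmx symS.
have /mxOverP dreal := hermitian_spectral_diag_real Sherm.
exists (spectralmx (cmx S)), (\row_i complex.Re (spectral_diag (cmx S) 0 i)).
split; first exact: spectral_unitarymx.
have /orthomx_spectralP := hermitian_normalmx Sherm.
rewrite invmx_unitary ?spectral_unitarymx //.
move: (spectralmx _) (spectral_diag _) dreal => U d dreal eS; rewrite eS.
suff -> : cmx (\row_i complex.Re (d 0 i)) = d by [].
by apply/rowP => i; rewrite !mxE RRe_real.
Qed.

Lemma spectral_pairN {p} (S : 'M[R]_p) U d :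
  spectral_pair S U d -> spectral_pair (- S) U (- d).
Proof.
case=> Uu e; split; first exact: Uu.
have -> : diag_mx (cmx (- d)) = - diag_mx (cmx d).
  by apply/matrixP => i k; rewrite !mxE rmorphN mulNrn.
by rewrite map_mxN e mulmxN mulNmx.
Qed.

(** Conjugation by [U] preserves the characteristic polynomial, which therefore splits over [R]. The
    diagonal is a witness that excludes the default [[::]] of [eigvals], and unique factorization
    fixes the roots up to order. *)
Lemma eigvals_spectral {p} (S : 'M[R]_p) U d :
  spectral_pair S U d -> perm_eq (eigvals S) [seq d 0 i | i : 'I_p].
Proof.
case=> Uu e.
have charS : char_poly S = \prod_(x <- [seq d 0 i | i : 'I_p]) ('X - x%:P).
  apply: (map_poly_inj (real_complex R)); rewrite map_char_poly e.
  have -> : char_poly (U ^t* *m diag_mx (cmx d) *m U) = char_poly (diag_mx (cmx d)).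
    rewrite /char_poly /char_poly_mx !map_mxM /=.
    have UU : map_mx polyC (U ^t*) *m map_mx polyC U = 1%:M.
      rewrite -map_mxM -(invmx_unitary Uu) mulVmx ?map_mx1 //.
      exact: unitarymx_unit.
    rewrite -[X in \det (X - _)]mulmx1 -UU mulmxA -[_%:M *m _]scalar_mxC.
    rewrite -mulmxBl -mulmxBr !det_mulmx mulrAC -det_mulmx UU det1 mul1r //.
  rewrite char_poly_trig ?diag_mx_is_trig //.
  rewrite big_map big_enum /= rmorph_prod /=; apply: eq_bigr => i _.
  by rewrite rmorphB /= map_polyX map_polyC !mxE eqxx mulr1n.
apply: prod_XsubC_eq; rewrite -charS; symmetry.
by rewrite /eigvals; case: xgetP => [s _ //|/(_ [seq d 0 i | i : 'I_p])].
Qed.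

Lemma count_codom {p} (P : pred R) (d : 'rV[R]_p) :
  count P [seq d 0 i | i : 'I_p] = #|[pred i | P (d 0 i)]|.
Proof.
by rewrite count_map -sum1_count -sum1_card big_enum_cond; apply: eq_bigl.
Qed.

Lemma npos_spectral {p} (S : 'M[R]_p) U d :
  spectral_pair S U d -> npos S = #|[pred i | 0 < d 0 i]|.
Proof.
move=> /eigvals_spectral /permP; rewrite /npos => ->.
by rewrite count_codom.
Qed.

Lemma msignE {p} (S : 'M[R]_p) : S^T = S -> msign S = (npos S)%:Z - (npos (- S))%:Z.
Proof.
move=> /spectral_pair_ex[U [d Sd]]; rewrite /msign -/(npos S).
congr (_ - Posz _); rewrite (npos_spectral (spectral_pairN Sd)).
rewrite (permP (eigvals_spectral Sd)) count_codom.
by apply: eq_card => i; rewrite !inE mxE oppr_gt0.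
Qed.

(** An identity matrix of the size of the support factors through [diag_mx d]: select the support,
    apply the diagonal, divide by its entries. *)
Lemma card_support_diag {F : fieldType} {p} (d : 'rV[F]_p) :
  (#|[pred i | (d 0 i != 0)%R]| <= \rank (diag_mx d))%N.
Proof.
set N := [pred i | d 0 i != 0].
pose E : 'M[F]_(#|N|, p) := rowsub enum_val 1%:M.
pose d' : 'rV[F]_p := \row_i (d 0 i)^-1.
have E1 : E *m diag_mx d *m (diag_mx d' *m E^T) = 1%:M.
  apply/matrixP => i k; rewrite mulmxA -(mulmxA E) mulmx_diag mul_mx_diag !mxE.
  rewrite (bigD1 (enum_val k)) //= big1 => [|l lk]; rewrite !mxE.
    rewrite addr0 eqxx mulr1 (inj_eq enum_val_inj) divff ?mulr1 //.
    exact: (enum_valP k).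
  by rewrite [in X in _ * X]eq_sym (negPf lk) mulr0.
rewrite -[leqLHS](mxrank1 F) -E1.
by rewrite (leq_trans (mxrankM_maxl _ _)) // mxrankM_maxr.
Qed.

Lemma npos_sum {p} (S : 'M[R]_p) U d : spectral_pair S U d ->
  (npos S + npos (- S))%N = #|[pred i | d 0 i != 0]|.
Proof.
move=> Sd; rewrite (npos_spectral Sd) (npos_spectral (spectral_pairN Sd)).
rewrite -cardUI [X in (_ + X)%N]eq_card0 ?addn0 => [|i]; last first.
  by rewrite !inE mxE oppr_gt0; case: ltgtP.
by apply: eq_card => i; rewrite !inE mxE oppr_gt0; case: ltgtP.
Qed.

(** The two indices together count the nonzero eigenvalues, at most the rank of the diagonal matrix,
    and unitary conjugation preserves that rank. *)
Lemma npos_rank {p} (S : 'M[R]_p) : S^T = S -> (npos S + npos (- S) <= \rank S)%N.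
Proof.
move=> /spectral_pair_ex[U [d Sd]]; rewrite (npos_sum Sd).
case: Sd => Uu e; apply: leq_trans (card_support_diag d) _.
rewrite -(mxrank_map (real_complex R) S) e -(mxrank_map (real_complex R)) map_diag_mx.
rewrite mxrankMfree ?row_free_unit ?unitarymx_unit //.
by rewrite eqmxMfull // row_full_unit -(invmx_unitary Uu) unitmx_inv unitarymx_unit.
Qed.

Lemma npos_unit {p} (S : 'M[R]_p) : S^T = S -> S \in unitmx ->
  (npos S + npos (- S))%N = p.
Proof.
move=> symS uS; apply/eqP; rewrite eqn_leq; apply/andP; split.
  by rewrite (leq_trans (npos_rank symS)) ?rank_leq_row.
have [U [d Sd]] := spectral_pair_ex symS.
rewrite (npos_sum Sd); case: Sd => Uu e.
have : cmx S \in unitmx by rewrite map_unitmx.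
rewrite e !unitmx_mul => /andP[/andP[_ ud] _].
rewrite -[leqLHS]card_ord; apply: subset_leq_card; apply/fintype.subsetP => i _.
move: ud; rewrite !inE unitmxE det_diag unitfE prodf_seq_neq0 => /allP /(_ i).
rewrite mem_index_enum => /(_ isT) /=; rewrite mxE; apply: contraNneq => ->.
by rewrite rmorph0.
Qed.

Lemma hermitian_form_diag {p q} (Y : 'M[C]_(q, p)) (U : 'M[C]_p) (d : 'rV[R]_p)
    (x : 'rV[C]_q) (z := x *m Y *m U ^t*) :
  (x *m Y *m (U ^t* *m diag_mx (cmx d) *m U) *m (x *m Y) ^t*) 0 0
  = \sum_i (d 0 i)%:C%C * `|z 0 i| ^+ 2.
Proof.
have -> : x *m Y *m (U ^t* *m diag_mx (cmx d) *m U) *m (x *m Y) ^t*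
    = z *m diag_mx (cmx d) *m z ^t*.
  by rewrite /z !trmx_mul !map_mxM /= -!map_trmx trmxK -map_mx_comp (map_mx_id (@conjCK _)) !mulmxA.
rewrite mul_mx_diag mxE; apply: eq_bigr => i _; rewrite !mxE normCK.
by rewrite mulrAC mulrC.
Qed.

(* On a subspace of dimension > npos S some nonzero vector is orthogonal to all
   eigenvectors with positive eigenvalue, and the form is nonpositive there. *)
Lemma leq_npos {p q} (S : 'M[R]_p) (Y : 'M[C]_(q, p)) : S^T = S ->
  (forall x : 'rV[C]_q, x != 0 -> 0 < (x *m Y *m cmx S *m (x *m Y) ^t*) 0 0) ->
  (q <= npos S)%N.
Proof.
move=> /spectral_pair_ex[U [d Sd]] posY; rewrite (npos_spectral Sd) leqNgt.
set N := [pred i | 0 < d 0 i]; apply/negP => Nq.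
pose Z : 'M[C]_(q, #|N|) := colsub enum_val (Y *m U ^t*).
have : kermx Z != 0.
  rewrite -mxrank_eq0 mxrank_ker subn_eq0 -ltnNge.
  by rewrite (leq_ltn_trans (rank_leq_col Z)).
case/rowV0Pn => x /sub_kermxP xZ x0.
have := posY x x0; case: Sd => _ ->; rewrite hermitian_form_diag.
apply/negP; rewrite le_gtF // sumr_le0 // => i _.
have [d0|d0] := lerP (d 0 i) 0.
  by rewrite mulr_le0_ge0 ?exprn_ge0 // lecR.
have -> : (x *m Y *m U ^t*) 0 i = 0; last by rewrite normr0 expr0n mulr0.
have iN : i \in N by [].
move/rowP/(_ (enum_rank_in iN i)): xZ; rewrite -mulmxA !mxE => xZ.
rewrite -[RHS]xZ; apply: eq_bigr => l _; rewrite [in RHS]mxE.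
by rewrite enum_rankK_in.
Qed.

Lemma hermitian_form_real {p} (S : 'M[R]_p) (w : 'rV[C]_p) : S^T = S ->
  (w *m cmx S *m w ^t*) 0 0 \is Num.real.
Proof.
move=> /spectral_pair_ex[U [d [_ ->]]].
have := hermitian_form_diag 1%:M U d w; rewrite mulmx1 => ->.
apply: rpred_sum => i _; rewrite rpredM ?rpredX ?normr_real //.
by apply/complex_realP; eexists.
Qed.

(** Each product [|w_i| |w_k|] is at most [|w_i|^2 + |w_k|^2], and in the double sum every square
    occurs [2 p] times. *)
Lemma hermitian_form_bound {p} (E : 'M[R]_p) (w : 'rV[C]_p) (b : R) :
  (forall i k, `|E i k| <= b) ->
  `|(w *m cmx E *m w ^t*) 0 0| <= (b * (2 * p%:R))%:C%C * \sum_i `|w 0 i| ^+ 2.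
Proof.
move=> Eb; have Eb' k i : `|(E k i)%:C%C| <= b%:C%C.
  by rewrite normc_def /= expr0n addr0 sqrtr_sqr lecR.
have -> : (b * (2 * p%:R))%:C%C * \sum_i `|w 0 i| ^+ 2
    = \sum_i \sum_k b%:C%C * (`|w 0 k| ^+ 2 + `|w 0 i| ^+ 2).
  set N := \sum_i `|w 0 i| ^+ 2; have -> : \sum_i \sum_k b%:C%C * (`|w 0 k| ^+ 2 + `|w 0 i| ^+ 2)
      = \sum_i (b%:C%C * (N + `|w 0 i| ^+ 2 *+ p)).
    by apply: eq_bigr => i _; rewrite -mulr_sumr big_split /= sumr_const card_ord.
  rewrite -mulr_sumr big_split /= sumr_const card_ord sumrMnl -/N.
  by rewrite rmorphM rmorphM !rmorph_nat -mulrA -natrM mulr_natl mulnC mulrnA mulr2n.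
rewrite mxE (le_trans (ler_norm_sum _ _ _)) //; apply: ler_sum => i _.
rewrite !mxE mulr_suml (le_trans (ler_norm_sum _ _ _)) //; apply: ler_sum => k _.
rewrite !mxE !normrM norm_conjC mulrAC mulrC ler_pM ?mulr_ge0 //.
have kreal := normr_real (w 0 k); have ireal := normr_real (w 0 i).
apply: le_trans (real_leif_mean_square_scaled kreal ireal).
by rewrite mulr2n lerDl mulr_ge0.
Qed.

Lemma sqnormE {p} (x : 'rV[C]_p) : \sum_i `|x 0 i| ^+ 2 = (x *m x ^t*) 0 0.
Proof. by rewrite mxE; apply: eq_bigr => i _; rewrite !mxE normCK. Qed.

Lemma sqnorm_unitary {p} (x : 'rV[C]_p) (U : 'M[C]_p) : U \is unitarymx ->
  \sum_i `|(x *m U) 0 i| ^+ 2 = \sum_i `|x 0 i| ^+ 2.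
Proof.
move=> Uu; rewrite !sqnormE trmx_mul map_mxM mulmxA -(mulmxA x).
by rewrite (unitarymxP Uu) mulmx1.
Qed.

(** On the span of the eigenvectors of [G] with positive eigenvalue, the form of [c *: G] is at
    least [c * lam] times the squared norm, which beats the error. [X] carries this span to a space
    where [S] is positive, and [leq_npos] concludes. The tolerance depends on [G] alone, hence is
    uniform in [S], [X] and [c]. *)
Lemma npos_stable {r} (G : 'M[R]_r) : G^T = G ->
  exists2 eps : R, 0 < eps & forall p (S : 'M[R]_p) (X : 'M[R]_(r, p)) (c : R),
    S^T = S -> 0 < c ->
    (forall i k, `|(X *m S *m X^T - c *: G) i k| <= eps * c) ->
    (npos G <= npos S)%N.
Proof.
move=> symG; have [U [d Gd]] := spectral_pair_ex symG; rewrite (npos_spectral Gd).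
set N := [pred i | 0 < d 0 i].
(* Starting the minimum at 1 keeps it positive even when [G] has no positive eigenvalue. *)
pose lam := \big[Num.min/1]_(i in N) d 0 i.
have lam0 : 0 < lam by apply: lt_bigmin.
have lamN i : 0 < d 0 i -> lam <= d 0 i by move=> di; exact: bigmin_le_cond.
(* The error form is bounded with factor [eps * (2 * r)]; dividing by [r.+1] makes this strictly
   less than [lam], also when [r = 0]. *)
pose eps := lam / (2 * r.+1%:R).
have eps0 : 0 < eps by rewrite divr_gt0 // mulr_gt0.
exists eps => // p S X c symS c0 close.
pose V : 'M[C]_(#|N|, r) := rowsub enum_val U.
apply: (@leq_npos _ _ _ (V *m cmx X) symS) => x x0.
pose w := x *m V; pose n2 := \sum_i `|w 0 i| ^+ 2.
pose E : 'M[R]_r := X *m S *m X^T - c *: G.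
have symE : E^T = E.
  by rewrite linearB linearZ /= symG !trmx_mul symS trmxK mulmxA.
have [Uu eG] := Gd.
(* The coordinates of [w] along the eigenvectors are those of [x], supported on [N]. This gives both
   [w != 0] and the lower bound by [lam]. *)
have VU : V *m U ^t* = rowsub enum_val 1%:M.
  by rewrite mul_rowsub_mx (unitarymxP Uu).
have w0 : w != 0.
  apply: contra_neq x0 => w0; apply/rowP => l.
  have : (x *m (V *m U ^t*)) 0 (enum_val l) = 0 by rewrite mulmxA -/w w0 mul0mx mxE.
  rewrite VU mxE (bigD1 l) //= big1 => [|k kl]; rewrite !mxE ?eqxx ?mulr1 ?addr0 //.
  by rewrite (inj_eq enum_val_inj) (negPf kl) mulr0.
have n20 : 0 < n2.
  rewrite lt_def sumr_ge0 ?andbT => [|i _]; last exact: exprn_ge0.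
  apply: contra_neq w0 => n20; apply/rowP => i; rewrite [RHS]mxE.
  have /eqP := psumr_eq0P (fun i _ => exprn_ge0 2 (normr_ge0 (w 0 i))) n20 (i := i) isT.
  by rewrite expf_eq0 normr_eq0 => /andP[_ /eqP->].
have wG : lam%:C%C * n2 <= (w *m cmx G *m w ^t*) 0 0.
  have := hermitian_form_diag 1%:M U d w; rewrite mulmx1 eG => ->.
  rewrite /n2 -(@sqnorm_unitary _ _ (U ^t*)) ?trmxC_unitary // mulr_sumr.
  apply: ler_sum => i _; have [d0|d0] := ltP 0 (d 0 i).
    by rewrite ler_wpM2r ?exprn_ge0 // lecR lamN.
  have -> : (w *m U ^t*) 0 i = 0; last by rewrite normr0 expr0n !mulr0.
  rewrite /w -mulmxA VU mxE big1 // => l _; rewrite !mxE.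
  case: eqP => [li|]; last by rewrite mulr0.
  by have := enum_valP l; rewrite li inE ltNge d0.
have wE : `|(w *m cmx E *m w ^t*) 0 0| <= (eps * c * (2 * r%:R))%:C%C * n2.
  exact: hermitian_form_bound.
have -> : (x *m (V *m cmx X) *m cmx S *m (x *m (V *m cmx X)) ^t*) 0 0
    = c%:C%C * (w *m cmx G *m w ^t*) 0 0 + (w *m cmx E *m w ^t*) 0 0.
  have -> : x *m (V *m cmx X) *m cmx S *m (x *m (V *m cmx X)) ^t* =
     w *m cmx (c *: G + E) *m w ^t*.
    rewrite addrC subrK !map_mxM /= mulmxA -/w trmx_mul map_mxM /= !mulmxA.
    congr (_ *m _ *m _); apply/matrixP => i k; rewrite !mxE.
    by apply/CrealP/complex_realP; eexists.
  by rewrite map_mxD mulmxDr mulmxDl mxE map_mxZ -scalemxAr -scalemxAl mxE.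
(* The form of the symmetric [E] is real, so the bound on its modulus yields a lower bound. *)
have Er := hermitian_form_real w symE.
have : - ((eps * c * (2 * r%:R))%:C%C * n2) <= (w *m cmx E *m w ^t*) 0 0.
  by rewrite lerNl (le_trans _ wE) // -normrN real_ler_norm ?rpredN.
have cG : c%:C%C * (lam%:C%C * n2) <= c%:C%C * (w *m cmx G *m w ^t*) 0 0.
  by rewrite ler_wpM2l // lecR ltW.
move=> /(lerD cG); apply: lt_le_trans.
rewrite mulrA -mulrBl mulr_gt0 // -rmorphM -rmorphB ltcR mulrAC [eps * _ * c]mulrC.
rewrite -mulrBr mulr_gt0 // subr_gt0 /eps.
rewrite mulrAC ltr_pdivrMr ?mulr_gt0 // ltr_pM2l // ltr_pM2l // ltr_nat //.
Qed.

(** [npos_stable] bounds both indices of [S] from below by those of [G], exchanged when [c < 0]. The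
    indices of [S] add up to at most [r] and those of [G] to exactly [r], so both bounds are
    equalities. *)
Lemma msign_stable {r} (G : 'M[R]_r) : G^T = G -> G \in unitmx ->
  exists2 eps : R, 0 < eps & forall p (S : 'M[R]_p) (X : 'M[R]_(r, p)) (c : R),
    S^T = S -> (\rank S <= r)%N -> c != 0 ->
    (forall i k, `|(X *m S *m X^T - c *: G) i k| <= eps * `|c|) ->
    msign S = sgz c * msign G.
Proof.
move=> symG uG; have symNG : (- G)^T = - G by rewrite linearN /= symG.
have [e1 e10 H1] := npos_stable symG; have [e2 e20 H2] := npos_stable symNG.
exists (Num.min e1 e2) => [|p S X c symS rS c0 close]; first by rewrite lt_min e10.
have symNS : (- S)^T = - S by rewrite linearN /= symS.
have c0' : 0 < `|c| by rewrite normr_gt0.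
have sumS := leq_trans (npos_rank symS) rS; have sumG := npos_unit symG uG.
have E1 i k : `|(X *m S *m X^T - c *: G) i k| <= e1 * `|c|.
  by rewrite (le_trans (close i k)) // ler_wpM2r // ge_min lexx.
have E2 i k : `|(X *m S *m X^T - c *: G) i k| <= e2 * `|c|.
  by rewrite (le_trans (close i k)) // ler_wpM2r // ge_min lexx orbT.
have NE i k : (X *m - S *m X^T - c *: - G) i k = - (X *m S *m X^T - c *: G) i k.
  by rewrite mulmxN mulNmx scalerN -opprD mxE.
have NE1 i k : (X *m - S *m X^T - (- c) *: G) i k = - (X *m S *m X^T - c *: G) i k.
  by rewrite -NE scaleNr scalerN.
have NE2 i k : (X *m S *m X^T - (- c) *: - G) i k = (X *m S *m X^T - c *: G) i k.
  by rewrite scaleNr scalerN opprK.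
rewrite !msignE //; have [c0E|cp|cn] := sgzP c; first by rewrite c0E eqxx in c0.
- have h1 : (npos G <= npos S)%N.
    by apply: (H1 _ S X c) => // i k; have := E1 i k; rewrite (gtr0_norm cp).
  have h2 : (npos (- G) <= npos (- S))%N.
    by apply: (H2 _ (- S) X c) => // i k; rewrite NE normrN; have := E2 i k; rewrite (gtr0_norm cp).
  lia.
- have h1 : (npos G <= npos (- S))%N.
    apply: (H1 _ (- S) X (- c)) => // [|i k]; first by rewrite oppr_gt0.
    by rewrite NE1 normrN; have := E1 i k; rewrite (ltr0_norm cn).
  have h2 : (npos (- G) <= npos S)%N.
    apply: (H2 _ S X (- c)) => // [|i k]; first by rewrite oppr_gt0.
    by rewrite NE2; have := E2 i k; rewrite (ltr0_norm cn).
  lia.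
Qed.

End Inertia.

(** * Germs of C^k functions and Taylor's formula *)

Section CkGerms.
Context {R : realType}.
Implicit Types (f g : R -> R) (t : R).
Local Open Scope classical_set_scope.

(** Differentiability is asked near [t], continuity of the last derivative at [t] itself. This
    depends on the germ alone, so identities that hold only near [t] can be used. *)
Fixpoint Ck_at (k : nat) f t : Prop :=
  if k is m.+1 then (\forall s \near t, derivable f s 1) /\ Ck_at m f^`() t
  else {for t, continuous f}.

Lemma near_eq_derive1 f g t :
  (\forall s \near t, f s = g s) -> \forall s \near t, f^`() s = g^`() s.
Proof.
move=> /near_join; apply: filterS => s fg; rewrite !derive1E.
exact: near_eq_derive.
Qed.

Lemma Ck_at_near_eq k f g t :
  (\forall s \near t, f s = g s) -> Ck_at k f t -> Ck_at k g t.
Proof.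
elim: k f g => [|k IH] f g fg /=.
  move=> cf; suff : g @ t --> f t by rewrite (nbhs_singleton fg).
  exact: cvg_trans (near_eq_cvg fg) cf.
case=> df Df; split; last exact: IH (near_eq_derive1 fg) Df.
move/near_join: fg => fg; near=> s.
by apply: (@near_eq_derivable _ _ _ f); near: s.
Unshelve. all: by end_near. Qed.

Lemma Ck_at_cst k (c t : R) : Ck_at k (fun=> c) t.
Proof.
elim: k c => [|k IH] c /=; first exact: cvg_cst.
split; first by near=> s; exact: derivable_cst.
by apply: Ck_at_near_eq (IH 0); near=> s; rewrite derive1_cst.
Unshelve. all: by end_near. Qed.

Lemma Ck_at_pred k f t : Ck_at k.+1 f t -> Ck_at k f t.
Proof.
elim: k f => [|k IH] f [df Df].
  exact/differentiable_continuous/derivable1_diffP/(nbhs_singleton df).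
by split=> //; apply: IH.
Qed.

Lemma Ck_at_cvg k f t : Ck_at k f t -> {for t, continuous f}.
Proof. by elim: k => // k IH /Ck_at_pred. Qed.

Lemma Ck_atD k f g t : Ck_at k f t -> Ck_at k g t -> Ck_at k (fun s => f s + g s) t.
Proof.
elim: k f g => [|k IH] f g /=; first exact: cvgD.
move=> [df Df] [dg Dg]; split.
  by apply: filterS2 df dg => s dfs dgs; exact: (derivableD dfs dgs).
apply: Ck_at_near_eq (IH _ _ Df Dg); apply: filterS2 df dg => s dfs dgs.
by rewrite !derive1E; have -> := deriveD dfs dgs.
Qed.

Lemma Ck_atM k f g t : Ck_at k f t -> Ck_at k g t -> Ck_at k (fun s => f s * g s) t.
Proof.
elim: k f g => [|k IH] f g; first exact: cvgM.
move=> Cf Cg; have [df Df] := Cf; have [dg Dg] := Cg; split.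
  by apply: filterS2 df dg => s dfs dgs; exact: (derivableM dfs dgs).
apply: Ck_at_near_eq (Ck_atD (IH _ _ Df (Ck_at_pred Cg)) (IH _ _ (Ck_at_pred Cf) Dg)).
apply: filterS2 df dg => s dfs dgs; rewrite !derive1E.
by have -> := deriveM dfs dgs; rewrite addrC; congr (_ + _); exact: mulrC.
Qed.

(** The derivative [- f' / f^2] is a product of [f'] with two copies of the inverse, to which the
    induction hypothesis applies one order lower. *)
Lemma Ck_atV k f t : f t != 0 -> Ck_at k f t -> Ck_at k (fun s => (f s)^-1) t.
Proof.
move=> f0; elim: k => [|k IH] Cf; first exact: cvgV.
have [df Df] := Cf; have CV := IH (Ck_at_pred Cf).
have fN0 : \forall s \near t, f s != 0.
  have /cvgr_neq0 := Ck_at_cvg Cf; exact.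
split; first by apply: filterS2 fN0 df => s fs dfs; exact: (derivableV fs dfs).
apply: Ck_at_near_eq (Ck_atM (Ck_at_cst k (-1) t) (Ck_atM Df (Ck_atM CV CV))).
apply: filterS2 fN0 df => s fs dfs; rewrite !derive1E.
have -> := deriveV fs dfs.
by rewrite mulN1r scaleNr; congr (- _); rewrite mulrC -invfM -expr2.
Qed.

Lemma Ck_at_sum k (I : Type) (r : seq I) (P : pred I) (F : I -> R -> R) t :
  (forall i, Ck_at k (F i) t) -> Ck_at k (fun s => \sum_(i <- r | P i) F i s) t.
Proof.
move=> CF; elim: r => [|i r IH].
  by under eq_fun do rewrite big_nil; exact: Ck_at_cst.
under eq_fun do rewrite big_cons; case: (P i) => //; exact: Ck_atD.
Qed.

Lemma Ck_at_prod k (I : Type) (r : seq I) (P : pred I) (F : I -> R -> R) t :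
  (forall i, Ck_at k (F i) t) -> Ck_at k (fun s => \prod_(i <- r | P i) F i s) t.
Proof.
move=> CF; elim: r => [|i r IH].
  by under eq_fun do rewrite big_nil; exact: Ck_at_cst.
under eq_fun do rewrite big_cons; case: (P i) => //; exact: Ck_atM.
Qed.

Lemma Ck_at_on k j f (A : set R) t : (j <= k)%N -> open A -> A t ->
  Ck_on k f A -> Ck_at j f t.
Proof.
move=> jk oA At [dk ck].
have nA : \forall s \near t, A s by exact: open_nbhs_nbhs.
(* Induction on the number [m] of derivatives still to take after [i] of them. At [i = j],
   continuity comes from the last clause of [Ck_on] if [j = k], and from differentiability
   otherwise. *)
suff H m i : (m + i = j)%N -> Ck_at m f^`(i) t.
  by rewrite -[f](derive1n0); apply: H; rewrite addn0.
elim: m i => [|m IH] i.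
  rewrite add0n => -> /=; move: jk; rewrite leq_eqVlt => /orP[/eqP->|jk]; first exact: ck.
  exact/differentiable_continuous/derivable1_diffP/dk.
move=> mij; split; last by rewrite -derive1nS; apply: IH; rewrite addnS -addSn.
by near=> s; apply: dk; [lia|near: s].
Unshelve. all: by end_near. Qed.

Lemma near_dist t (P : R -> Prop) : (\forall s \near t, P s) ->
  exists2 d : R, 0 < d & forall s, `|s - t| < d -> P s.
Proof.
move=> /nbhs_ballP[d /= d0 dP]; exists d => // s st; apply: dP.
by rewrite /ball /= distrC.
Qed.

(** The mean value theorem, on either side of [t], gives a point no farther from [t] than [s], where
    the bound on the derivative applies. Keeping the constant [C] lets the Taylor induction run with
    a fixed [e]. *)
Lemma MVT_bound f t (d C : R) m : 0 < d -> f t = 0 -> 0 <= C ->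
  (forall s, `|s - t| < d -> derivable f s 1) ->
  (forall s, `|s - t| < d -> `|f^`() s| <= C * `|s - t| ^+ m) ->
  forall s, `|s - t| < d -> `|f s| <= C * `|s - t| ^+ m.+1.
Proof.
move=> d0 ft C0 df f'C s sd.
have [->|st] := eqVneq s t; first by rewrite ft normr0 mulr_ge0 ?exprn_ge0.
have [c cs fsE] : exists2 c, `|c - t| <= `|s - t| & f s = derive1 f c * (s - t).
  have dd x : `|x - t| <= `|s - t| -> is_derive x 1 f (derive1 f x).
    move=> xs; rewrite derive1E; apply: DeriveDef => //; apply: df.
    exact: le_lt_trans sd.
  have cc x : `|x - t| <= `|s - t| -> {for x, continuous f}.
    move=> xs; apply/differentiable_continuous/derivable1_diffP/df.
    exact: le_lt_trans sd.
  have [lt_st|lt_ts] : s < t \/ t < s by case: ltgtP st; auto.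
    have itv x : x \in `[s, t]%R -> `|x - t| <= `|s - t|.
      by rewrite in_itv /= => /andP[sx xt]; rewrite !ler0_norm ?subr_le0 //; lra.
    have [c cst e] := MVT lt_st (fun x xst => dd x (itv x (subset_itv_oo_cc xst)))
      (continuous_in_subspaceT (fun x xst => cc x (itv x (set_mem xst)))).
    exists c; first exact/itv/subset_itv_oo_cc.
    by move: e; rewrite ft sub0r => e; rewrite -[f s]opprK e; ring.
  have itv x : x \in `[t, s]%R -> `|x - t| <= `|s - t|.
    by rewrite in_itv /= => /andP[sx xt]; rewrite !ger0_norm ?subr_ge0 //; lra.
  have [c cst e] := MVT lt_ts (fun x xst => dd x (itv x (subset_itv_oo_cc xst)))
      (continuous_in_subspaceT (fun x xst => cc x (itv x (set_mem xst)))).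
  exists c; first exact/itv/subset_itv_oo_cc.
  by move: e; rewrite ft subr0.
rewrite fsE normrM exprSr mulrA ler_wpM2r //.
rewrite (le_trans (f'C c _)) ?(le_lt_trans cs) // ler_wpM2l //.
by rewrite lerXn2r ?nnegrE.
Qed.

Lemma is_derive_monomial (c t : R) n (s : R) :
  is_derive s 1 (fun u : R => c * (u - t) ^+ n) (c * (n%:R * (s - t) ^+ n.-1)).
Proof.
have -> : (fun u : R => c * (u - t) ^+ n) = c \*: ((@idfun R - cst t) ^+ n).
  by apply/funext => u; rewrite !fctE.
by apply: is_derive_eq; rewrite subr0 /GRing.scale /= mulr1.
Qed.

(** Induction on [j]: the expansion of the derivative of [f] is integrated by [MVT_bound] applied to
    [f] minus its leading monomial [p]. *)
Lemma Taylor_Peano j f t : Ck_at j f t ->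
  (forall i, (i < j)%N -> f^`(i) t = 0) ->
  forall e, 0 < e -> \forall s \near t,
    `|f s - derive1n j f t / j`!%:R * (s - t) ^+ j| <= e * `|s - t| ^+ j.
Proof.
elim: j f => [|j IH] f Cf f0 e e0.
  have /cvgr_dist_le /(_ e e0) : f @ t --> f t by [].
  apply: filterS => s; by rewrite expr0 fact0 !mulr1 invr1 mulr1 distrC.
have [df Df] := Cf; set a := derive1n j.+1 f t.
pose p (s : R) : R := a / (j.+1)`!%:R * (s - t) ^+ j.+1.
pose p' (s : R) : R := a / j`!%:R * (s - t) ^+ j.
have dp (s : R) : is_derive s 1 p (p' s).
  apply: is_derive_eq (is_derive_monomial _ t _ _) _; rewrite /p' factS natrM /=.
  by field; rewrite nat1r !pnatr_eq0 -lt0n fact_gt0.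
have f'0 i : (i < j)%N -> derive1n i (derive1 f) t = 0.
  by move=> ij; have := f0 i.+1 ij; rewrite /derive1n iterSr.
have f'P := IH _ Df f'0 e e0.
have [d d0 fd] : exists2 d : R, 0 < d & forall s, `|s - t| < d ->
    derivable f s 1 /\ `|derive1 f s - p' s| <= e * `|s - t| ^+ j.
  apply: near_dist; apply: filterS2 df f'P => s dfs f's; split=> //.
  by move: f's; rewrite /p' /a /derive1n iterSr.
have dg s : `|s - t| < d -> is_derive s 1 (f - p) (derive1 f s - p' s).
  move=> /fd[dfs _]; apply: is_deriveB; rewrite derive1E; exact: DeriveDef.
near=> s; rewrite -/(p s) -/((f - p) s).
apply: (@MVT_bound (f - p) t d e j) => //; [|exact: ltW| |].
- rewrite !fctE /p subrr expr0n mulr0 subr0; exact: (f0 0%N).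
- by move=> u /dg.
- by move=> u ud; have [_ fu] := fd u ud; have dgu := dg u ud; rewrite derive1E derive_val.
Unshelve. all: by end_near. Qed.
End CkGerms.

(** * Matrices with C^k entries *)

Section CkMatrix.
Context {R : realType}.
Implicit Types (t : R) (k : nat).

Definition Ck_mx k {m n} (M : R -> 'M[R]_(m, n)) t : Prop :=
  forall i j, Ck_at k (fun s => M s i j) t.

Lemma Ck_mx_cst k m n (A : 'M[R]_(m, n)) t : Ck_mx k (fun=> A) t.
Proof. by move=> i j; exact: Ck_at_cst. Qed.

Lemma Ck_mxM k m n p (A : R -> 'M[R]_(m, n)) (B : R -> 'M[R]_(n, p)) t :
  Ck_mx k A t -> Ck_mx k B t -> Ck_mx k (fun s => A s *m B s) t.
Proof.
move=> CA CB i j; under eq_fun do rewrite mxE.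
by apply: Ck_at_sum => l; exact: Ck_atM.
Qed.

Lemma Ck_mx_tr k m n (A : R -> 'M[R]_(m, n)) t :
  Ck_mx k A t -> Ck_mx k (fun s => (A s)^T) t.
Proof. by move=> CA i j; under eq_fun do rewrite mxE; exact: CA. Qed.

Lemma Ck_det k n (A : R -> 'M[R]_n) t :
  Ck_mx k A t -> Ck_at k (fun s => \det (A s)) t.
Proof.
move=> CA; apply: Ck_at_sum => u; apply: Ck_atM; first exact: Ck_at_cst.
by apply: Ck_at_prod => i.
Qed.

(** Cramer's rule. [invmx] agrees with the adjugate formula only where the determinant is nonzero,
    which is a neighbourhood of [t]. *)
Lemma Ck_mx_inv k n (A : R -> 'M[R]_n) t : A t \in unitmx ->
  Ck_mx k A t -> Ck_mx k (fun s => invmx (A s)) t.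
Proof.
move=> uA CA i j; have CdA := Ck_det CA.
have dA0 : \det (A t) != 0 by rewrite -unitfE -unitmxE.
have adjC : Ck_at k (fun s => (\adj (A s)) i j) t.
  under eq_fun do rewrite mxE.
  apply: Ck_atM; first exact: Ck_at_cst.
  by apply: Ck_det => a b; under eq_fun do rewrite !mxE; exact: CA.
apply: Ck_at_near_eq (Ck_atM (Ck_atV dA0 CdA) adjC).
have /cvgr_neq0 /(_ dA0) := Ck_at_cvg CdA; apply: filterS => s ds.
by rewrite /invmx unitmxE unitfE ds [in RHS]mxE.
Qed.

Lemma near_unitmx k n (A : R -> 'M[R]_n) t : A t \in unitmx ->
  Ck_mx k A t -> (\forall s \near t, A s \in unitmx)%classic.
Proof.
rewrite unitmxE unitfE => dA0 /Ck_det/Ck_at_cvg/cvgr_neq0/(_ dA0).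
by apply: filterS => s ds; rewrite unitmxE unitfE.
Qed.

End CkMatrix.

(** * Lagrangian planes and an explicit formula for the graph map *)

Section GraphMap.
Context {R : realType} {n : nat}.
Local Notation J := (Jmx R n).
Implicit Types (W L : 'M[R]_(n, n + n)).

Lemma trmx_J : J^T = - J.
Proof.
by rewrite /Jmx tr_block_mx !trmx0 linearN /= !trmx1 opp_block_mx !oppr0 opprK.
Qed.

Lemma J_unit : J \in unitmx.
Proof.
suff JJ : J *m - J = 1%:M by case/mulmx1_unit: JJ.
rewrite /Jmx mulmxN mulmx_block !mul0mx !mulmx0 !add0r !addr0 mul1mx mulmx1.
by rewrite opp_block_mx !oppr0 !opprK -scalar_mx_block.
Qed.

Lemma omegaE m p (A : 'M[R]_(m, n + n)) (B : 'M[R]_(p, n + n)) i k :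
  omega (row i A)^T (row k B)^T = (A *m J *m B^T) i k.
Proof.
rewrite /omega trmxK -row_mul tr_row colE mulmxA -row_mul -colE.
by rewrite !mxE.
Qed.

Lemma lagrangian_isotropic m (S : 'M[R]_(m, n + n)) :
  lagrangian S -> S *m J *m S^T = 0.
Proof.
move=> [_ S0]; apply/matrixP => i k; rewrite -omegaE [RHS]mxE.
by apply: S0; rewrite /inS trmxK row_sub.
Qed.

(** The symplectic orthogonal of [W] has dimension [n] as [J] is invertible, and it contains [W], so
    it equals [W]. *)
Lemma lagrangian_maximal W m (X : 'M[R]_(m, n + n)) : lagrangian W ->
  X *m J *m W^T = 0 -> (X <= W)%MS.
Proof.
move=> lW; have W0 := lagrangian_isotropic lW; case: lW => rW _.
rewrite -mulmxA => /sub_kermxP XK.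
have WK : (W <= kermx (J *m W^T))%MS by apply/sub_kermxP; rewrite mulmxA.
have rK : \rank (kermx (J *m W^T)) = n.
  by rewrite mxrank_ker eqmxMfull ?row_full_unit ?J_unit // mxrank_tr rW addnK.
have := mxrank_leqif_sup WK; rewrite rK rW => -[_ /esym]; rewrite eqxx.
exact: submx_trans XK.
Qed.

(** This is the matrix of [omega] between [L] and [W]. A kernel vector gives an element of [L]
    orthogonal to [W], hence lying in [W], hence zero. *)
Lemma transverse_unit W L : lagrangian W -> lagrangian L ->
  \rank (W :&: L)%MS = 0%N -> L *m J *m W^T \in unitmx.
Proof.
move=> lW [rL _] /eqP; rewrite mxrank_eq0 => /eqP WL0.
rewrite -row_free_unit; apply: inj_row_free => x; rewrite !mulmxA.
move=> /(lagrangian_maximal lW) xW.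
have : (x *m L <= W :&: L)%MS by rewrite sub_capmx xW submxMl.
by rewrite WL0 submx0 mulmx_free_eq0 ?/row_free ?rL // => /eqP.
Qed.

Lemma graph_mapE W L0 Lt (T := L0 *m J *m W^T *m invmx (Lt *m J *m W^T)) :
  lagrangian W -> lagrangian L0 -> Lt *m J *m W^T \in unitmx ->
  graph_map W L0 Lt *m L0^T = (T *m Lt - L0)^T.
Proof.
move=> lW lL0 ut; have rL0 : row_free L0 by rewrite /row_free lL0.1.
have TW : (T *m Lt - L0 <= W)%MS.
  apply: lagrangian_maximal => //.
  by rewrite !mulmxBl -!(mulmxA T) /T mulmxKV // subrr.
(* The default of [xget] is excluded by exhibiting a graph map: [pinvmx L0] extends the values
   prescribed on the rows of [L0]. *)
rewrite /graph_map; case: xgetP => [A _ HA|/(_ (pinvmx L0 *m (T *m Lt - L0))^T) []].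
  apply: trmx_inj; rewrite trmx_mul !trmxK; apply/row_matrixP => i.
  have [] : inS (A *m (row i L0)^T) W /\ inS ((row i L0)^T + A *m (row i L0)^T) Lt.
    by apply: HA; rewrite /inS trmxK row_sub.
  rewrite /inS linearD /= trmx_mul trmxK -row_mul => AW /submxP[y yE].
  (* Pairing [v + A v], with coordinates [y] in [Lt], against [W] kills [A v] because [W] is
     isotropic; an invertible linear system for [y] remains. *)
  have : y *m (Lt *m J *m W^T) = row i (L0 *m J *m W^T).
    have [z zE] := submxP AW.
    rewrite !mulmxA -yE !mulmxDl zE -(mulmxA z) -(mulmxA z) lagrangian_isotropic //.
    by rewrite mulmx0 addr0 -!row_mul.
  move=> /(congr1 (mulmx^~ (invmx (Lt *m J *m W^T)))); rewrite mulmxK // -row_mul -/T => yT.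
  by apply: (addrI (row i L0)); rewrite yE yT -row_mul -linearD /= addrC subrK.
move=> v; rewrite /inS => /submxP[x xE]; set A := (pinvmx L0 *m _)^T.
have AvE : (A *m v)^T = x *m (T *m Lt - L0).
  rewrite trmx_mul trmxK xE mulmxA -(mulmxA x); congr (_ *m _).
  by rewrite mulmxVp // mulmx1.
rewrite linearD /= AvE xE -mulmxDr [L0 + _]addrC subrK mulmxA submxMl; split=> //.
exact: submx_trans (submxMl _ _) TW.
Qed.

End GraphMap.

(** * The crossing form as a C^k family of symmetric matrices *)

Section CrossingForm.
Context {R : realType} {n : nat}.
Local Notation J := (Jmx R n).
Implicit Types (W L : 'M[R]_(n, n + n)).

(* The matrix of (u, v) |-> omega(u, A v) in the basis of ell(t0) given by the rows of L0. *)
Definition crossing_mx W L0 Lt : 'M[R]_n :=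
  L0 *m J *m (L0 *m J *m W^T *m invmx (Lt *m J *m W^T) *m Lt)^T.

Lemma crossing_mxE W L0 Lt :
  lagrangian W -> lagrangian L0 -> Lt *m J *m W^T \in unitmx ->
  L0 *m J *m graph_map W L0 Lt *m L0^T = crossing_mx W L0 Lt.
Proof.
move=> lW lL0 ut; rewrite -mulmxA graph_mapE // linearB /= mulmxBr.
by rewrite lagrangian_isotropic // subr0.
Qed.

Lemma omega_graph W L0 Lt (x : 'rV[R]_n) (v := (x *m L0)^T) :
  lagrangian W -> lagrangian L0 -> Lt *m J *m W^T \in unitmx ->
  omega v (graph_map W L0 Lt *m v) = (x *m crossing_mx W L0 Lt *m x^T) 0 0.
Proof.
move=> lW lL0 ut; rewrite -crossing_mxE // /omega /v trmxK trmx_mul.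
by rewrite !mulmxA.
Qed.

(** The rows of [D] lie in [W], so [omega] vanishes on them. Expanding with [L0] and [Lt] isotropic
    leaves two cross terms, whose equality is the symmetry because [J] is antisymmetric. *)
Lemma crossing_mx_sym W L0 Lt :
  lagrangian W -> lagrangian L0 -> lagrangian Lt -> Lt *m J *m W^T \in unitmx ->
  (crossing_mx W L0 Lt)^T = crossing_mx W L0 Lt.
Proof.
move=> lW lL0 lLt ut; rewrite /crossing_mx.
set T := L0 *m J *m W^T *m _; set D := T *m Lt - L0.
have DW : (D <= W)%MS.
  apply: lagrangian_maximal => //.
  by rewrite !mulmxBl -!(mulmxA T) /T mulmxKV // subrr.
have [z zE] := submxP DW.
have : D *m J *m D^T = 0.
  rewrite zE trmx_mul -(mulmxA z) -(mulmxA z) (mulmxA (W *m J)).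
  by rewrite lagrangian_isotropic // mul0mx mulmx0.
rewrite /D linearB /= mulmxBr !mulmxBl (lagrangian_isotropic lL0) subr0.
rewrite {1}trmx_mul -!(mulmxA T) (mulmxA (Lt *m J)) (lagrangian_isotropic lLt).
rewrite mul0mx mulmx0 sub0r => /eqP; rewrite subr_eq0 => /eqP DJ.
rewrite trmx_mul trmxK trmx_mul trmx_J mulNmx mulmxN.
by rewrite -[RHS]opprK DJ -!mulmxA.
Qed.

(** Supplies the Taylor coefficient of order 0, since the hypotheses on crossing forms start at
    order 1. *)
Lemma crossing_mx0 W L : lagrangian L -> L *m J *m W^T \in unitmx ->
  crossing_mx W L L = 0.
Proof. by move=> lL uL; rewrite /crossing_mx mulmxV // mul1mx lagrangian_isotropic. Qed.

Lemma Ck_crossing_mx k W (F : R -> 'M[R]_(n, n + n)) L0 t :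
  F t *m J *m W^T \in unitmx -> Ck_mx k F t ->
  Ck_mx k (fun s => crossing_mx W L0 (F s)) t.
Proof.
move=> ut CF; apply: Ck_mxM; first exact: Ck_mx_cst.
apply: Ck_mx_tr; apply: Ck_mxM => //; apply: Ck_mxM; first exact: Ck_mx_cst.
apply: Ck_mx_inv => //.
by do 2![apply: Ck_mxM; last exact: Ck_mx_cst].
Qed.

Lemma crossQ_expansion W (F : R -> 'M[R]_(n, n + n)) (t0 : R) j (x : 'rV[R]_n)
    (v := (x *m F t0)^T) :
  lagrangian W -> lagrangian (F t0) -> F t0 *m J *m W^T \in unitmx ->
  Ck_mx j F t0 -> (0 < j)%N ->
  (forall i, (0 < i < j)%N -> crossQ F W t0 i v = 0) ->
  forall e, 0 < e -> (\forall s \near t0,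
    `|(x *m crossing_mx W (F t0) (F s) *m x^T) 0 0
      - crossQ F W t0 j v / j`!%:R * (s - t0) ^+ j| <= e * `|s - t0| ^+ j)%classic.
Proof.
move=> lW lF u0 CF j0 Q0 e e0.
have uC : Ck_mx j (fun s => F s *m J *m W^T) t0.
  by do 2![apply: Ck_mxM; last exact: Ck_mx_cst].
have nu := near_unitmx u0 uC.
pose f s := omega v (graph_map W (F t0) (F s) *m v).
(* [crossQ] differentiates the form of [graph_map], which has the rational expression only while the
   plane stays transverse to [W], so near [t0]. *)
have fE : (\forall s \near t0,
    (x *m crossing_mx W (F t0) (F s) *m x^T) 0 0 = f s)%classic.
  by apply: filterS nu => s us; rewrite /f omega_graph.
have Cf : Ck_at j f t0.
  apply: (Ck_at_near_eq fE).
  apply: Ck_mxM; last exact: Ck_mx_cst.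
  apply: Ck_mxM; first exact: Ck_mx_cst.
  exact: Ck_crossing_mx.
have f0 i : (i < j)%N -> derive1n i f t0 = 0.
  case: i => [_|i ij]; last exact: (Q0 i.+1 ij).
  by rewrite derive1n0 /f omega_graph // crossing_mx0 // mulmx0 mul0mx mxE.
have := Taylor_Peano Cf f0 e0; apply: filterS2 fE => s fs.
by rewrite -fs.
Qed.

End CrossingForm.

(** * Compression by the orthogonal projection *)

Section OrthProj.
Context {R : realType}.

Lemma gram_unit m p (B : 'M[R]_(m, p)) : row_free B -> B *m B^T \in unitmx.
Proof.
move=> fB; rewrite -row_free_unit; apply: inj_row_free => x xB.
have : (x *m B) *m (x *m B)^T = 0 by rewrite trmx_mul mulmxA -(mulmxA x) xB mul0mx.
have : (x *m B == 0) = (x == 0) by rewrite mulmx_free_eq0.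
move: (x *m B) => y y0 /matrixP /(_ 0 0); rewrite !mxE => /psumr_eq0P yy.
apply/eqP; rewrite -y0; apply/eqP/rowP => i.
have /eqP : y 0 i * y^T i 0 = 0 by apply: yy => // l _; rewrite mxE -expr2 sqr_ge0.
by rewrite !mxE -expr2 expf_eq0 => /= /eqP.
Qed.

(** With [N] the inverse Gram matrix, [P X P] equals [B^T N (B X B^T) N B]: symmetry and rank are
    read off, and compressing by [B] gives back [B X B^T]. *)
Lemma orth_proj_compress m p (B : 'M[R]_(m, p)) (X : 'M[R]_p)
    (P := B^T *m invmx (B *m B^T) *m B) :
  row_free B -> (B *m X *m B^T)^T = B *m X *m B^T ->
  [/\ (P *m X *m P)^T = P *m X *m P, (\rank (P *m X *m P) <= m)%N &
      B *m (P *m X *m P) *m B^T = B *m X *m B^T].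
Proof.
move=> fB symX; have uB := gram_unit fB; rewrite {}/P.
have NT : (invmx (B *m B^T))^T = invmx (B *m B^T) by rewrite trmx_inv trmx_mul trmxK.
have BN : B *m B^T *m invmx (B *m B^T) = 1%:M by rewrite mulmxV.
have NB : invmx (B *m B^T) *m (B *m B^T) = 1%:M by rewrite mulVmx.
move: (invmx _) NT BN NB => N NT BN NB.
have -> : B^T *m N *m B *m X *m (B^T *m N *m B) = B^T *m N *m (B *m X *m B^T) *m (N *m B).
  by rewrite !mulmxA.
move: (B *m X *m B^T) symX => H symX; split.
- by rewrite !trmx_mul trmxK NT symX !mulmxA.
- by rewrite (leq_trans (mxrankM_maxr _ _)) // (leq_trans (mxrankM_maxr _ _)) ?rank_leq_row.
- by rewrite !mulmxA BN mul1mx -mulmxA -mulmxA NB mulmx1.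
Qed.

End OrthProj.

(** * Signature of the projected matrix near the crossing *)

Section Signature.
Context {R : realType} {n : nat}.
Local Notation J := (Jmx R n).

Lemma polarization m (C : 'M[R]_m) (x y : 'rV[R]_m) : C^T = C ->
  (x *m C *m y^T) 0 0 =
    (((x + y) *m C *m (x + y)^T) 0 0 - (x *m C *m x^T) 0 0 - (y *m C *m y^T) 0 0) / 2.
Proof.
move=> symC; have yx : (y *m C *m x^T) 0 0 = (x *m C *m y^T) 0 0.
  by rewrite -[in LHS](trmxK (_ *m x^T)) [in LHS]mxE !trmx_mul trmxK symC mulmxA.
have -> : ((x + y) *m C *m (x + y)^T) 0 0 = (x *m C *m x^T) 0 0
    + (x *m C *m y^T) 0 0 + (y *m C *m x^T) 0 0 + (y *m C *m y^T) 0 0.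
  by rewrite linearD /= mulmxDr !mulmxDl !mxE; ring.
by rewrite yx; field.
Qed.

Lemma gram_sym m (q : 'cV[R]_(n + n) -> R) (S : 'M[R]_(m, n + n)) :
  (gram q S)^T = gram q S.
Proof.
apply/matrixP => i k; rewrite !mxE; congr (_ / 2); rewrite addrAC.
by congr (q _ - _ - _); rewrite addrC.
Qed.

(** In a basis [B] of [K], polarization turns the expansions of the quadratic forms into an
    entrywise estimate against the Gram matrix of the crossing form, which is what [msign_stable]
    takes. *)
Lemma crossing_signature W (F : R -> 'M[R]_(n, n + n)) (t0 : R) j m
    (K : 'M[R]_(m, n + n)) (P := orth_proj K) :
  lagrangian W -> (\forall s \near t0, lagrangian (F s))%classic ->
  F t0 *m J *m W^T \in unitmx -> Ck_mx j F t0 -> (0 < j)%N -> (K <= F t0)%MS ->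
  (forall i, (0 < i < j)%N -> forall v, inS v K -> crossQ F W t0 i v = 0) ->
  nondeg_on (crossQ F W t0 j) K ->
  (\forall s \near t0, s != t0 ->
    msign (P *m J *m graph_map W (F t0) (F s) *m P) =
      sgz ((s - t0) ^+ j) * qsign_on (crossQ F W t0 j) K)%classic.
Proof.
move=> lW nF u0 CF j0 KF Q0 nd; have lF0 := nbhs_singleton nF.
have uC : Ck_mx j (fun s => F s *m J *m W^T) t0.
  by do 2![apply: Ck_mxM; last exact: Ck_mx_cst].
have nu := near_unitmx u0 uC.
set B := row_base K.
have /submxP[X BE] : (B <= F t0)%MS by rewrite eq_row_base.
have rowB i : (row i B)^T = (row i X *m F t0)^T by rewrite BE row_mul.
have QX i (x : 'rV_(\rank K)) : (0 < i < j)%N ->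
    crossQ F W t0 i (x *m X *m F t0)^T = 0.
  move=> ij; apply: Q0 => //; rewrite /inS trmxK -mulmxA -BE.
  by rewrite (submx_trans (submxMl _ _)) // eq_row_base.
have [eps eps0 stable] := msign_stable (gram_sym (crossQ F W t0 j) K) nd.
have fact0 : 0 < j`!%:R :> R by rewrite ltr0n fact_gt0.
(* Polarization adds three expansion errors and halves them; three halves of [e] is below [2 * e],
   which is [eps] times the factor [1 / j!] in the scale [c]. *)
pose e := eps / (2 * j`!%:R).
have e0 : 0 < e by rewrite divr_gt0 // mulr_gt0.
pose close s x := `|(x *m X *m crossing_mx W (F t0) (F s) *m (x *m X)^T) 0 0
  - crossQ F W t0 j (x *m X *m F t0)^T / j`!%:R * (s - t0) ^+ j| <= e * `|s - t0| ^+ j.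
have closeP x : (\forall s \near t0, close s x)%classic.
  by apply: crossQ_expansion => // i ij; exact: QX.
(* The expansion holds near [t0] for each fixed vector. Polarization uses only basis vectors and
   their pairwise sums, finitely many, so one neighbourhood serves all entries. *)
pose dl (i : 'I_(\rank K)) : 'rV[R]_(\rank K) := delta_mx 0 i.
have close1 : (\forall s \near t0, forall i, close s (dl i))%classic.
  exact: (@filter_forall R 'I_(\rank K) (fun i s => close s (dl i)) (nbhs t0) _ (fun i => closeP (dl i))).
have close2 : (\forall s \near t0, forall ik, close s (dl ik.1 + dl ik.2))%classic.
  exact: (@filter_forall R ('I_(\rank K) * 'I_(\rank K))%type (fun ik s => close s (dl ik.1 + dl ik.2)) (nbhs t0) _ (fun ik => closeP _)).
have FF : Filter (nbhs t0) := nbhs_filter t0.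
apply: filterS2 (filterI nu nF) (filterI close1 close2) => s [us lFs] [c1 c2] st.
have symC := crossing_mx_sym lW lF0 lFs us.
have BJB : B *m (J *m graph_map W (F t0) (F s)) *m B^T = X *m crossing_mx W (F t0) (F s) *m X^T.
  by rewrite -crossing_mxE // BE (trmx_mul X) !mulmxA.
rewrite /close in c1 c2.
move: (crossing_mx W (F t0) (F s)) c1 c2 symC BJB => C c1 c2 symC BJB.
have fB : row_free B by exact: row_base_free.
have [] := @orth_proj_compress R _ _ B (J *m graph_map W (F t0) (F s)) fB.
  by rewrite BJB !trmx_mul trmxK symC mulmxA.
rewrite -/(orth_proj K) -/P BJB !(mulmxA P J) => symM rM BMB.
(* Dividing by the positive [j!] leaves the sign unchanged, and [s != t0] makes the scale
   nonzero. *)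
set c := (s - t0) ^+ j / j`!%:R.
have c0 : c != 0 by rewrite mulf_neq0 ?expf_neq0 ?subr_eq0 // invr_neq0 ?gt_eqF.
rewrite (stable _ _ B c symM rM c0) => [|i k].
  by rewrite /c sgzM [X in _ * X * _]gtr0_sgz ?invr_gt0 // mulr1.
rewrite BMB.
have -> : (X *m C *m X^T - c *: gram (crossQ F W t0 j) K) i k =
   (X *m C *m X^T) i k - c * gram (crossQ F W t0 j) K i k by rewrite !mxE.
have -> : (X *m C *m X^T) i k = (dl i *m X *m C *m (dl k *m X)^T) 0 0.
  have -> : dl i *m X *m C *m (dl k *m X)^T = dl i *m (X *m C *m X^T) *m delta_mx k 0.
    by rewrite trmx_mul trmx_delta !mulmxA.
  by rewrite -rowE -colE !mxE.
have dlB l : (row l B)^T = (dl l *m X *m F t0)^T by rewrite rowB rowE.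
have -> : gram (crossQ F W t0 j) K i k =
    (crossQ F W t0 j ((dl i + dl k) *m X *m F t0)^T
     - crossQ F W t0 j (dl i *m X *m F t0)^T - crossQ F W t0 j (dl k *m X *m F t0)^T) / 2.
  rewrite /gram mxE -/B.
  by rewrite !mulmxDl linearD /= -!dlB.
rewrite (polarization (dl i *m X) (dl k *m X) symC).
have mD : (dl i + dl k) *m X = dl i *m X + dl k *m X := mulmxDl _ _ _.
have := c1 i; have := c1 k; have := c2 (i, k); rewrite /= mD /c normrM normfV.
rewrite (gtr0_norm fact0) normrX /e.
move: (crossQ _ _ _ _ _) (crossQ _ _ _ _ _) (crossQ _ _ _ _ _) => q1 q2 q3.
move: ((_ *m _ *m _) 0 0) ((_ *m _ *m _) 0 0) ((_ *m _ *m _) 0 0) => p1 p2 p3.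
have a0 : 0 <= eps / (2 * j`!%:R) * `|s - t0| ^+ j by rewrite mulr_ge0 ?exprn_ge0 // ltW.
have f0 : j`!%:R != 0 :> R by rewrite gt_eqF.
have -> : eps * (`|s - t0| ^+ j / j`!%:R) = 2 * (eps / (2 * j`!%:R) * `|s - t0| ^+ j).
  by field.
have -> : (p3 - p1 - p2) / 2 - (s - t0) ^+ j / j`!%:R * ((q3 - q1 - q2) / 2)
  = ((p3 - q3 / j`!%:R * (s - t0) ^+ j) - (p1 - q1 / j`!%:R * (s - t0) ^+ j)
     - (p2 - q2 / j`!%:R * (s - t0) ^+ j)) / 2 by field.
move: (p3 - _) (p1 - _) (p2 - _) (_ * _) a0 => y3 y1 y2 d d0.
by rewrite !ler_norml => /andP[? ?] /andP[? ?] /andP[? ?]; apply/andP; split; lra.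
Qed.

End Signature.

(** * Comparison of the two sides of the crossing *)

Unset Implicit Arguments. Set Strict Implicit. Set Printing Implicit Defensive.

Theorem theorem2 (R : realType) (n k j : nat) (a b t0 : R)
  (F : R -> 'M[R]_(n, n + n)) (Ls : 'M[R]_(n, n + n)) :
  a < b ->
  Ck_path k F a b ->
  (forall t, a <= t <= b -> lagrangian (F t)) ->
  lagrangian Ls ->
  (0 < j <= k)%N ->
  a < t0 < b ->
  \rank (F t0 :&: Ls)%MS != 0%N ->
  (exists2 e : R, 0 < e & forall t, 0 < `|t - t0| < e -> \rank (F t :&: Ls)%MS = 0%N) ->
  forall W : 'M[R]_(n, n + n), lagrangian W -> \rank (W :&: F t0)%MS = 0%N ->
  (forall i, (0 < i < j)%N -> forall v, inS v (F t0 :&: Ls)%MS -> crossQ F W t0 i v = 0) ->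
  nondeg_on (crossQ F W t0 j) (F t0 :&: Ls)%MS ->
  exists2 d0 : R, 0 < d0 & forall d, 0 < d < d0 ->
    Mas_loc F Ls W t0 d =
      (if odd j then (qsign_on (crossQ F W t0 j) (F t0 :&: Ls)%MS)%:~R else 0).
Proof.
move=> _ CF lF _ /andP[j0 jk] abt _ _ W lW WF Q0 nd.
have lF0 : lagrangian (F t0) by apply: lF; case/andP: abt => /ltW -> /ltW ->.
have u0 := transverse_unit lW lF0 WF.
have oab : open (fun t : R => a < t < b).
  rewrite (_ : (fun t : R => _) = `]a, b[%classic); first exact: interval_open.
  by apply/seteqP; split => t; rewrite /= in_itv.
have nF : (\forall s \near t0, lagrangian (F s))%classic.
  have : (\forall s \near t0, a < s < b)%classic by exact: open_nbhs_nbhs.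
  by apply: filterS => s /andP[/ltW as_ /ltW sb]; apply: lF; rewrite as_.
have CFj : Ck_mx j F t0.
  by move=> i l; exact: (Ck_at_on jk oab abt (CF i l)).
have /near_dist[d0 d00 sgn] :=
  crossing_signature lW nF u0 CFj j0 (capmxSl _ _) Q0 nd.
exists d0 => // d /andP[dp dd0]; rewrite /Mas_loc.
rewrite !sgn; try by rewrite ?opprK addrAC subrr add0r ?normrN gtr0_norm.
- rewrite (addrC t0 d) addrK (addrC t0 (- d)) addrK.
  (* The sign of [(- d) ^+ j] is that of [(-1) ^+ j]: for even [j] the two signatures cancel, for
     odd [j] they add up and the factor 1/2 in [Mas_loc] leaves one. *)
  rewrite -[- d]mulN1r exprMn -signr_odd !sgzM (gtr0_sgz (exprn_gt0 _ dp)).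
  case: (odd j); rewrite ?expr1 ?expr0 ?sgzN ?sgz1 !mul1r ?mulN1r ?subrr ?mul0r //.
  by rewrite rmorphN opprK; field.
- by rewrite -subr_eq0 addrAC subrr add0r oppr_eq0 gt_eqF.
- by rewrite -subr_eq0 addrAC subrr add0r gt_eqF.
Qed.
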